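(* Let $I$ be a monomial ideal in $R=K[x_1,\ldots,x_n]$ and let $<$ be a total order on $G(I)=\{m_1<m_2<\cdots<m_\mu\}$. Then $\mathcal{L}_{\bullet(I,<)}=\mathcal{CL}_{\bullet(I,<)}$; that is, the Lyubeznik resolution and the combinatorial Lyubeznik resolution of $I$ with respect to $<$ are equal (under the identification of the basis element $F=\{m_{i_1}<\cdots<m_{i_t}\}$ with the symbol $u(i_1;\ldots;i_t)$).
   Context: $K$ is a field and $G(I)$ denotes the minimal set of monomial generators of $I$, written $G(I)=\{m_1<\cdots<m_\mu\}$ in increasing order for the given total order $<$ (an arbitrary total order on the set $G(I)$). For $A\subseteq G(I)$, $\mathrm{lcm}(A)$ is the least common multiple of the elements of $A$ (with $\mathrm{lcm}(\emptyset)=1$). A symbol is $u(i_1;\ldots;i_t)$ with $1\le i_1<\cdots<i_t\le\mu$; it is $L$-admissible (of dimension $t$) if for all $h<t$ and all $q<i_h$, $m_q$ does not divide $\mathrm{lcm}(m_{i_h},m_{i_{h+1}},\ldots,m_{i_t})$. Lyubeznik resolution $\mathcal{L}_{\bullet(I,<)}$: $L^0=R$, and for $t\ge1$, $L^t$ is the free $R$-module with basis the $L$-admissible symbols of dimension $t$; the differential $\partial_t:L^t\to L^{t-1}$ is $$\partial_t(u(i_1;\ldots;i_t))=\sum_{j=1}^t(-1)^{j+1}\frac{\mathrm{lcm}(m_{i_1},\ldots,m_{i_t})}{\mathrm{lcm}(m_{i_1},\ldots,\widehat{m_{i_j}},\ldots,m_{i_t})}\,u(i_1;\ldots;\widehat{i_j};\ldots;i_t),$$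 and $L^0=R\to R/I$ is the augmentation. Lyubeznik complex: $\Delta_{(I,<)}=\{F\subseteq G(I) : \min\{u\in G(I): u\mid \mathrm{lcm}(H)\}\in H \text{ for all nonempty } H\subseteq F\}$ (minimum with respect to $<$), and $\Delta_i=\{F\in\Delta_{(I,<)}:|F|=i\}$. Combinatorial Lyubeznik resolution $\mathcal{CL}_{\bullet(I,<)}$: the module in homological degree $i$ is the free $R$-module with basis $\Delta_i$ (so it is $R$ for $i=0$), and for $F=\{u_{j_1}<\cdots<u_{j_i}\}\in\Delta_i$ with $G_k=F\setminus\{u_{j_k}\}$, $$\partial(F)=\sum_{k=1}^{i}\varepsilon_F^{G_k}\frac{\mathrm{lcm}(F)}{\mathrm{lcm}(G_k)}\,G_k,$$ where $\varepsilon_F^{G_k}=1$ for $k$ odd and $-1$ for $k$ even; again augmented by $R\to R/I$. *)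

(* Defs.v *)
From HB Require Import structures.
From mathcomp Require Export all_boot all_order all_algebra ring_quotient finmap mpoly.

Set Implicit Arguments.
Unset Strict Implicit.
Unset Printing Implicit Defensive.

Import GRing.Theory.
Local Open Scope fset_scope.
Local Open Scope ring_scope.

Section MonomialIdeals.
Variables (K : fieldType) (n : nat).

Definition ideal_span (S : 'X_{1..n} -> Prop) (p : {mpoly K[n]}) : Prop :=
  exists (s : seq 'X_{1..n}) (c : 'X_{1..n} -> {mpoly K[n]}),
    (forall m, m \in s -> S m) /\ p = \sum_(m <- s) c m * 'X_[m].

Definition generates (S : 'X_{1..n} -> Prop) (I : {pred {mpoly K[n]}}) : Prop :=
  forall p, p \in I <-> ideal_span S p.

Definition monomial_ideal (I : {pred {mpoly K[n]}}) : Prop :=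
  exists S : 'X_{1..n} -> Prop, generates S I.

Definition min_monomial_generators
    (I : {pred {mpoly K[n]}}) (G : {fset 'X_{1..n}}) : Prop :=
  generates (fun m => m \in G) I /\
  forall G' : {fset 'X_{1..n}}, G' `<` G -> ~ generates (fun m => m \in G') I.

End MonomialIdeals.

Definition total_order (T : Type) (le : rel T) : Prop :=
  [/\ reflexive le, antisymmetric le, transitive le & total le].

Section Lcm.
Variable n : nat.

Lemma mlcmA : associative (@mlcm n).
Proof. by move=> a b c; apply/mnmP=> i; rewrite !mnmE maxnA. Qed.

HB.instance Definition _ :=
  Monoid.isComLaw.Build 'X_{1..n} 0%MM (@mlcm n) mlcmA (@mlcmC n) (@mlc0m n).

Lemma lem_biglcm (I : finType) (P : pred I) (F : I -> 'X_{1..n}) m :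
  (\big[@mlcm n/0%MM]_(i | P i) F i <= m)%MM = [forall (i | P i), (F i <= m)%MM].
Proof.
apply/idP/forall_inP => [h i Pi|h].
  by move: h; rewrite (bigD1 i) //= lem_mlcm => /andP[].
elim/big_rec: _ => [|i x Pi IH]; first by apply/mnm_lepP=> i; rewrite mnmE.
by rewrite lem_mlcm h.
Qed.

End Lcm.

Section Lyubeznik.
Variables (K : fieldType) (n : nat) (G : {fset 'X_{1..n}}) (le : rel G).

Local Notation R := {mpoly K[n]}.
Local Notation mu := #|{: G}|.

Definition gen (i : 'I_mu) : G := tnth (sort_tuple le (enum_tuple {: G})) i.

Definition tuple_lcm t (s : t.-tuple 'I_mu) : 'X_{1..n} :=
  \big[@mlcm n/0%MM]_(k < t) val (gen (tnth s k)).

Definition tail_lcm t (s : t.-tuple 'I_mu) (h : 'I_t) : 'X_{1..n} :=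
  \big[@mlcm n/0%MM]_(k < t | (h <= k)%N) val (gen (tnth s k)).

Definition increasing t (s : t.-tuple 'I_mu) : bool :=
  [forall h : 'I_t, forall k : 'I_t, (h < k)%N ==> (tnth s h < tnth s k)%N].

(* Positions are counted from 0: the last one is excluded by h.+1 < t. *)
Definition L_admissible t (s : t.-tuple 'I_mu) : bool :=
  [forall h : 'I_t, (h.+1 < t)%N ==>
    [forall q : 'I_mu, (q < tnth s h)%N ==>
       ~~ (val (gen q) <= tail_lcm s h)%MM]].

Definition symbol (t : nat) :=
  {s : t.-tuple 'I_mu | increasing s && L_admissible s}.

Definition del_tuple t (s : t.+1.-tuple 'I_mu) (j : 'I_t.+1) : t.-tuple 'I_mu :=
  [tuple tnth s (lift j k) | k < t].

Lemma ltn_lift t (j : 'I_t.+1) (h k : 'I_t) :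
  (lift j h < lift j k)%N = (h < k)%N.
Proof. by rewrite /= !ltnNge leq_bump2. Qed.

Lemma del_tuple_symbol t (s : symbol t.+1) (j : 'I_t.+1) :
  increasing (del_tuple (val s) j) && L_admissible (del_tuple (val s) j).
Proof.
case: s => s /= /andP[/forallP inc /forallP adm]; apply/andP; split.
  apply/forallP=> h; apply/forallP=> k; rewrite !tnth_mktuple; apply/implyP=> hk.
  by move/forallP/(_ (lift j k))/implyP: (inc (lift j h)); apply; rewrite ltn_lift.
apply/forallP=> h; apply/implyP=> ht; apply/forallP=> q; rewrite tnth_mktuple.
apply/implyP=> hq.
have h1 : ((lift j h).+1 < t.+1)%N.
  by rewrite ltnS /= /bump; case: (j <= h)%N => //=; rewrite add0n ltnW.
move/implyP/(_ h1)/forallP/(_ q)/implyP/(_ hq): (adm (lift j h)).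
apply: contra => hle; apply: (lepm_trans hle); rewrite /tail_lcm lem_biglcm.
apply/forall_inP=> k hk; rewrite tnth_mktuple.
have : (tail_lcm s (lift j h) <= tail_lcm s (lift j h))%MM by exact: lepm_refl.
rewrite {1}/tail_lcm lem_biglcm => /forall_inP; apply.
by rewrite /= leq_bump2.
Qed.

Definition del_symbol t (s : symbol t.+1) (j : 'I_t.+1) : symbol t :=
  Sub (del_tuple (val s) j) (del_tuple_symbol s j).

(* Degree 0 is R itself; a free module on a finite basis B is {ffun B -> R}. *)
Definition Lyub (t : nat) : lmodType R :=
  if t is t'.+1 then {ffun symbol t'.+1 -> R^o} else R^o.

Definition Lyub_basis (t : nat) : symbol t -> Lyub t :=
  match t return symbol t -> Lyub t with
  | 0 => fun _ => 1 : R^o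
  | t'.+1 => fun s => [ffun s' => (s' == s)%:R] : {ffun symbol t'.+1 -> R^o}
  end.

(* The sign (-1)^(j+1) of a position j >= 1 is (-1)^j when j is counted from 0.
   The quotient of two lcms is 'X_[m - m'], where m' divides m, so that the
   truncated subtraction of exponents is exact. *)
Definition Lyub_diff_basis t (s : symbol t.+1) : Lyub t :=
  \sum_(j < t.+1)
    ((-1) ^+ j * 'X_[K, tuple_lcm (val s) - tuple_lcm (val (del_symbol s j))])
      *: Lyub_basis (del_symbol s j).

Definition Lyub_diff t (x : Lyub t.+1) : Lyub t :=
  \sum_(s : symbol t.+1)
    (x : {ffun symbol t.+1 -> R^o}) s *: Lyub_diff_basis s.

Definition Lyub_aug (I : zmodClosed R) (x : Lyub 0) : {ideal_quot I} :=
  \pi_({ideal_quot I})%qT (x : R).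

Definition set_lcm (A : {set G}) : 'X_{1..n} :=
  \big[@mlcm n/0%MM]_(u in A) val u.

Definition is_min (A : {set G}) (u : G) : bool :=
  (u \in A) && [forall v in A, le u v].

Definition Lyub_complex : {set {set G}} :=
  [set F : {set G} | [forall H : {set G}, (H \subset F) && (H != set0) ==>
     [exists u in H, is_min [set v | (val v <= set_lcm H)%MM] u]]].

Definition face (t : nat) := {F : {set G} | (F \in Lyub_complex) && (#|F| == t)}.

Lemma empty_face_proof : (set0 \in Lyub_complex) && (#|@set0 G| == 0%N).
Proof.
rewrite cards0 eqxx andbT inE; apply/forallP=> H; apply/implyP.
by rewrite subset0 => /andP[->].
Qed.

Definition empty_face : face 0 := Sub set0 empty_face_proof.

Definition face_elt t (F : face t) (k : 'I_#|val F|) : G :=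
  tnth (sort_tuple le (enum_tuple (val F))) k.

Lemma del_face_proof t (F : face t.+1) (k : 'I_#|val F|) :
  (val F :\ face_elt k \in Lyub_complex) && (#|val F :\ face_elt k| == t).
Proof.
have Fk : face_elt k \in val F.
  by have := mem_tnth k (sort_tuple le (enum_tuple (val F)));
     rewrite mem_sort mem_enum.
case/andP: (valP F) => cF /eqP sF; apply/andP; split; last first.
  have := cardsD1 (face_elt k) (val F); rewrite Fk => e.
  by apply/eqP/succn_inj; apply: etrans sF; rewrite e.
move: cF; rewrite !inE => /forallP cF; apply/forallP=> H.
apply/implyP=> /andP[sH nH]; apply: (implyP (cF H)).
by rewrite nH andbT (subset_trans sH) // subsetDl.
Qed.

Definition del_face t (F : face t.+1) (k : 'I_#|val F|) : face t :=
  Sub (val F :\ face_elt k) (del_face_proof k).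

Definition CLyub (t : nat) : lmodType R := {ffun face t -> R^o}.

Definition CLyub_basis t (F : face t) : CLyub t := [ffun F' => (F' == F)%:R].

(* Positive on odd positions when counted from 1; here k is counted from 0. *)
Definition face_sign (k : nat) : R := if odd k.+1 then 1 else -1.

Definition CLyub_diff_basis t (F : face t.+1) : CLyub t :=
  \sum_(k < #|val F|)
    (face_sign k * 'X_[K, set_lcm (val F) - set_lcm (val (del_face k))])
      *: CLyub_basis (del_face k).

Definition CLyub_diff t (x : CLyub t.+1) : CLyub t :=
  \sum_(F : face t.+1)
    (x : {ffun face t.+1 -> R^o}) F *: CLyub_diff_basis F.

Definition CLyub_aug (I : zmodClosed R) (x : CLyub 0) : {ideal_quot I} :=
  \pi_({ideal_quot I})%qT ((x : {ffun face 0 -> R^o}) empty_face : R).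

Definition symbol_set t (s : symbol t) : {set G} :=
  [set gen (tnth (val s) k) | k : 'I_t].

End Lyubeznik.

(* Main.v *)
From HB Require Import structures.
Require Import Defs.
Set Implicit Arguments.
Unset Strict Implicit.
Unset Printing Implicit Defensive.
Import GRing.Theory.
Local Open Scope fset_scope.
Local Open Scope ring_scope.

(** Both complexes are free modules on sets of increasing lists of generators,
    with the same differential formula, so they agree as soon as the two sets of
    lists do: an increasing list s has to be L-admissible exactly when its
    underlying set F is a face of the Lyubeznik complex ([L_admissibleE]).

    If F is a face, apply the face condition to the tail of s that starts at
    position h: the least generator dividing the lcm of that tail belongs to
    the tail, hence is not below its first element, and this is admissibility
    at h.  Conversely, let s be admissible and let H be a nonempty subset of F.
    Let u be the least element of H, at position h of s.  The lcm of H divides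
    the lcm of the tail from h, so admissibility at h says that no generator
    below u divides the lcm of H, which makes u the required minimum.  Nothing
    is known at the last position; but there H = {u}, and a generator dividing
    u equals u because the minimal generators of I form an antichain for
    divisibility ([min_monomial_generators_antichain]).

    Each face is the set of exactly one increasing list, which gives a bijection
    between symbols and faces in every degree.  Pulling coefficient functions
    back along it is the isomorphism of complexes.  It commutes with the
    differentials because the j-th element of a face in increasing order is the
    j-th entry of its symbol, so that deleting either one gives corresponding
    basis elements with the same sign and the same lcms
    ([pullback_diff_basis]). *)

(** * Minimal monomial generators form an antichain *)

Section Antichain.
Variables (K : fieldType) (n : nat).

(** The list of monomials in a combination may repeat a generator; collecting
    coefficients makes each generator occur once, so that a single one can then
    be eliminated. *)
Lemma ideal_span_fsetP (G : {fset 'X_{1..n}}) (p : {mpoly K[n]}) :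
  ideal_span (fun m => m \in G) p <->
  exists c : 'X_{1..n} -> {mpoly K[n]}, p = \sum_(m <- G) c m * 'X_[m].
Proof.
split=> [[s [c [sG ->]]]|[c ->]]; last by exists (enum_fset G), c.
exists (fun m => \sum_(m' <- s | m' == m) c m').
under [RHS]eq_bigr => m _ do rewrite mulr_suml big_mkcond.
rewrite exchange_big /=; apply: eq_big_seq => m' /sG m'G.
rewrite (bigD1_seq m') ?fset_uniq //= eqxx big1 ?addr0 // => m /negbTE mm'.
by rewrite eq_sym mm'.
Qed.

(** If u properly divides v, then v is redundant: its coefficient can be moved
    to u after multiplication by the quotient of v by u. *)
Lemma min_monomial_generators_antichain (I : {pred {mpoly K[n]}})
    (G : {fset 'X_{1..n}}) (u v : 'X_{1..n}) :
  min_monomial_generators I G -> u \in G -> v \in G -> (u <= v)%MM -> u = v.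
Proof.
move=> [genG minG] uG vG uv; apply/eqP/negPn/negP=> neq.
apply: (minG (G `\ v)); first exact: fproperD1.
have uGv : u \in G `\ v by rewrite !inE neq uG.
move=> p; split; last first.
  move=> [s [c [sG ->]]]; apply/genG; exists s, c; split=> // m /sG.
  by rewrite !inE => /andP[].
move=> /genG/ideal_span_fsetP[c ->]; apply/ideal_span_fsetP.
exists (fun m => c m + (m == u)%:R * (c v * 'X_[v - u])).
rewrite (big_fsetD1 v vG) /=.
under [RHS]eq_bigr => m _ do rewrite mulrDl.
rewrite big_split /= addrC; congr (_ + _).
rewrite (big_fsetD1 u uGv) /= eqxx mul1r -mulrA -mpolyXD submK //.
rewrite big1_fset ?addr0 // => m; rewrite !inE => /andP[/negbTE-> _] _.
by rewrite !mul0r.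
Qed.

End Antichain.

(** * Admissible symbols and faces *)

Section Correspondence.
Variables (n : nat) (G : {fset 'X_{1..n}}) (le : rel G).
Hypothesis le_total : total_order le.
Hypothesis G_antichain : forall u v : G, (val u <= val v)%MM -> u = v.

Local Notation mu := #|{: G}|.

Lemma gen_inj : injective (gen le).
Proof. by apply/tuple_uniqP; rewrite sort_uniq enum_uniq. Qed.

Lemma gen_surj (u : G) : exists i, u = gen le i.
Proof. by apply/tnthP; rewrite mem_sort mem_enum. Qed.

Lemma gen_leE (i j : 'I_mu) : le (gen le i) (gen le j) = (i <= j)%N.
Proof.
case: le_total => le_refl le_anti le_trans le_tot.
have homo (i' j' : 'I_mu) : (i' <= j')%N -> le (gen le i') (gen le j').
  rewrite /gen => ij; rewrite !(tnth_nth (gen le i')).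
  apply: (sorted_leq_nth le_trans le_refl) => //; first exact: sort_sorted.
  - by rewrite inE size_tuple.
  - by rewrite inE size_tuple.
apply/idP/idP=> [leij|]; last exact: homo.
rewrite leqNgt; apply/negP=> ji.
have /gen_inj eq_ij : gen le i = gen le j.
  by apply: le_anti; rewrite leij homo // ltnW.
by rewrite eq_ij ltnn in ji.
Qed.

Let lt_pos : rel 'I_mu := fun i j => (i < j)%N.

Let lt_pos_trans : transitive lt_pos.
Proof. by move=> ? ? ?; exact: ltn_trans. Qed.

Let lt_pos_irr : irreflexive lt_pos.
Proof. by move=> ?; exact: ltnn. Qed.

Lemma increasing_sorted t (s : t.-tuple 'I_mu) :
  increasing s = sorted (fun i j : 'I_mu => (i < j)%N) s.
Proof.
rewrite (sorted_pairwise lt_pos_trans).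
apply/'forall_forallP/idP => [inc|/pairwiseP srt h k].
  case: t s inc => [|t] s inc; first by rewrite tuple0.
  have x0 : 'I_mu := tnth s ord0.
  apply/(pairwiseP x0) => h k; rewrite !inE size_tuple => ht kt hk.
  have := implyP (inc (Ordinal ht) (Ordinal kt)) hk.
  by rewrite !(tnth_nth x0).
have x0 : 'I_mu := tnth s h.
apply/implyP=> hk; rewrite !(tnth_nth x0); apply: srt => //;
  by rewrite inE size_tuple.
Qed.

Lemma increasing_uniq t (s : t.-tuple 'I_mu) : increasing s -> uniq s.
Proof.
by rewrite increasing_sorted; exact: (sorted_uniq lt_pos_trans lt_pos_irr).
Qed.

Lemma increasing_inj t (s : t.-tuple 'I_mu) :
  increasing s -> injective (tnth s).
Proof. by move=> /increasing_uniq/tuple_uniqP. Qed.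

(** Unlike [symbol_set], this applies to tuples not known to be symbols, which
    is what comparing admissibility with the face condition requires. *)
Definition tuple_set t (s : t.-tuple 'I_mu) : {set G} :=
  [set gen le (tnth s k) | k : 'I_t].

Lemma mem_tuple_set t (s : t.-tuple 'I_mu) i :
  (gen le i \in tuple_set s) = (i \in tval s).
Proof.
apply/imsetP/tnthP => [[k _ /gen_inj]|[k ->]]; by exists k.
Qed.

Lemma lem_set_lcm (A : {set G}) u : u \in A -> (val u <= set_lcm A)%MM.
Proof.
move=> uA; have := lepm_refl (set_lcm A).
by rewrite {1}/set_lcm lem_biglcm => /forall_inP; apply.
Qed.

Lemma set_lcm_tuple_set t (s : t.-tuple 'I_mu) :
  increasing s -> set_lcm (tuple_set s) = tuple_lcm le s.
Proof.
move=> /increasing_inj s_inj; rewrite /set_lcm /tuple_set.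
by rewrite big_imset //= => h k _ _ /gen_inj/s_inj.
Qed.

(** Admissibility only tests the tails of s, while the face condition tests all
    subsets.  The tails suffice because the lcm of a subset divides the lcm of
    the tail that starts at its least element. *)
Lemma L_admissibleE t (s : t.-tuple 'I_mu) :
  increasing s -> L_admissible le s = (tuple_set s \in Lyub_complex le).
Proof.
move=> inc.
have leq_inc (h k : 'I_t) : (h <= k)%N -> (tnth s h <= tnth s k)%N.
  rewrite leq_eqVlt => /orP[/eqP/val_inj->//|hk]; apply: ltnW.
  exact: (implyP (forallP (forallP inc h) k)).
apply/idP/idP => [adm|].
  rewrite inE; apply/forallP=> H; apply/implyP=> /andP[/subsetP HF].
  case/set0Pn=> w wH; have /imsetP[k0 _ def_w] := HF _ wH.
  pose P k := gen le (tnth s k) \in H.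
  have Pk0 : P k0 by rewrite /P -def_w.
  case: (arg_minnP (fun k : 'I_t => nat_of_ord k) Pk0) => h Ph minh.
  apply/existsP; exists (gen le (tnth s h)); rewrite [_ \in H]Ph /is_min inE.
  rewrite lem_set_lcm //=; apply/forall_inP=> v; rewrite inE => v_dvd.
  have [q def_v] := gen_surj v; rewrite def_v gen_leE leqNgt.
  apply/negP=> q_lt.
  (* Admissibility says nothing at the last position; there H is a singleton. *)
  have [h_last|h_last] := ltnP h.+1 t.
    have := implyP (forallP (implyP (forallP adm h) h_last) q) q_lt.
    apply/negP/negPn; rewrite -def_v; apply: lepm_trans v_dvd _.
    rewrite /set_lcm lem_biglcm; apply/forall_inP=> u uH.
    have /imsetP[k _ def_u] := HF _ uH.
    have := lepm_refl (tail_lcm le s h).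
    rewrite {1}/tail_lcm lem_biglcm => /forall_inP/(_ k); rewrite -def_u; apply.
    by apply: minh; rewrite /P -def_u.
  have H1 u : u \in H -> u = gen le (tnth s h).
    move=> uH; have /imsetP[k _ def_u] := HF _ uH.
    rewrite def_u; congr (gen le (tnth s _)); apply/val_inj/eqP.
    rewrite eqn_leq minh ?andbT; last by rewrite /P -def_u.
    exact: leq_trans (ltn_ord k) h_last.
  have : v = gen le (tnth s h).
    apply: G_antichain; apply: lepm_trans v_dvd _.
    rewrite /set_lcm lem_biglcm; apply/forall_inP=> u /H1->.
    exact: lepm_refl.
  by rewrite def_v => /gen_inj eq_q; rewrite eq_q ltnn in q_lt.
rewrite inE => /forallP cF; apply/forallP=> h; apply/implyP=> _.
apply/forallP=> q; apply/implyP=> q_lt; apply/negP=> q_dvd.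
(* The face condition is applied to the tail of s starting at position h. *)
pose H : {set G} := [set gen le (tnth s k) | k : 'I_t & (h <= k)%N].
have H_lcm : (tail_lcm le s h <= set_lcm H)%MM.
  rewrite /tail_lcm lem_biglcm; apply/forall_inP=> k hk.
  by apply: lem_set_lcm; apply/imsetP; exists k; rewrite ?inE.
have HF : (H \subset tuple_set s) && (H != set0).
  apply/andP; split; last first.
    apply/set0Pn; exists (gen le (tnth s h)); apply/imsetP.
    by exists h; rewrite ?inE.
  by apply/subsetP=> _ /imsetP[k _ ->]; apply/imsetP; exists k.
have /existsP[u /andP[/imsetP[k hk ->]]] := implyP (cF H) HF.
case/andP=> _ /forall_inP/(_ (gen le q)); rewrite inE gen_leE.
rewrite (lepm_trans q_dvd H_lcm) leqNgt => /(_ isT)/negP; apply.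
by apply: leq_trans q_lt _; apply: leq_inc; rewrite inE in hk.
Qed.

Lemma card_tuple_set t (s : t.-tuple 'I_mu) :
  increasing s -> #|tuple_set s| = t.
Proof.
move=> /increasing_inj s_inj; rewrite card_imset ?card_ord //.
by move=> h k /gen_inj/s_inj.
Qed.

(** This identifies the positions of a face, which are defined by sorting, with
    the positions of its symbol; signs agree because of it. *)
Lemma sort_tuple_set t (s : t.-tuple 'I_mu) :
  increasing s -> sort le (enum (tuple_set s)) = [seq gen le i | i <- s].
Proof.
case: (le_total) => le_refl le_anti le_trans le_tot.
move=> inc; apply: (sorted_eq le_trans le_anti).
- exact: sort_sorted.
- move: inc; rewrite increasing_sorted sorted_map => srt.
  apply: sub_sorted srt => i j /=.
  by rewrite gen_leE; exact: ltnW.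
rewrite perm_sort; apply: uniq_perm; rewrite ?enum_uniq //.
  by rewrite (map_inj_uniq gen_inj) increasing_uniq.
move=> u; have [i ->] := gen_surj u.
by rewrite mem_enum mem_tuple_set (mem_map gen_inj).
Qed.

Lemma symbol_set_face t (s : symbol le t) :
  (symbol_set s \in Lyub_complex le) && (#|symbol_set s| == t).
Proof.
have /andP[inc adm] := valP s.
rewrite -[symbol_set s]/(tuple_set (val s)) -L_admissibleE // adm.
by rewrite card_tuple_set /=.
Qed.

Definition face_of_symbol t (s : symbol le t) : face le t :=
  Sub (symbol_set s) (symbol_set_face s).

(** The enumeration of ordinals is increasing, so no sorting is needed to turn a
    face into an increasing tuple. *)
Definition positions (F : {set G}) : seq 'I_mu := enum (gen le @^-1: F).

Lemma mem_positions F i : (i \in positions F) = (gen le i \in F).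
Proof. by rewrite mem_enum inE. Qed.

Lemma size_positions t (F : face le t) : size (positions (val F)) == t.
Proof.
rewrite -cardE on_card_preimset; first by have /andP[] := valP F.
by apply: onW_bij; apply: inj_card_bij gen_inj _; rewrite card_ord.
Qed.

Definition face_tuple t (F : face le t) : t.-tuple 'I_mu :=
  Tuple (size_positions F).

Lemma increasing_face_tuple t (F : face le t) : increasing (face_tuple F).
Proof.
rewrite increasing_sorted /= /positions /enum_mem.
apply: sorted_filter; first exact: lt_pos_trans.
rewrite -enumT; have := iota_ltn_sorted 0 mu.
by rewrite -val_enum_ord sorted_map.
Qed.

Lemma tuple_set_face_tuple t (F : face le t) : tuple_set (face_tuple F) = val F.
Proof.
apply/setP=> u; have [i ->] := gen_surj u.
by rewrite mem_tuple_set mem_positions.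
Qed.

Lemma face_tuple_symbol t (F : face le t) :
  increasing (face_tuple F) && L_admissible le (face_tuple F).
Proof.
have inc := increasing_face_tuple F; rewrite inc L_admissibleE //.
by rewrite tuple_set_face_tuple; have /andP[] := valP F.
Qed.

Definition symbol_of_face t (F : face le t) : symbol le t :=
  Sub (face_tuple F) (face_tuple_symbol F).

Lemma symbol_of_faceK t : cancel (@symbol_of_face t) (@face_of_symbol t).
Proof. by move=> F; apply: val_inj; apply: tuple_set_face_tuple. Qed.

Lemma face_of_symbolK t : cancel (@face_of_symbol t) (@symbol_of_face t).
Proof.
move=> s; apply/val_inj/val_inj => /=; have /andP[inc _] := valP s.
apply: (irr_sorted_eq lt_pos_trans lt_pos_irr).
- by have := increasing_face_tuple (face_of_symbol s); rewrite increasing_sorted.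
- by rewrite increasing_sorted in inc.
by move=> i; rewrite mem_positions -mem_tuple_set.
Qed.

(** The index types of k and j are only provably equal, since a face is indexed
    by its cardinality; their values are compared instead of casting one. *)
Lemma face_elt_face_of_symbol t (s : symbol le t)
    (k : 'I_#|val (face_of_symbol s)|) (j : 'I_t) :
  k = j :> nat -> face_elt k = gen le (tnth (val s) j).
Proof.
move=> kj; have /andP[inc _] := valP s; have x0 := tnth (val s) j.
rewrite /face_elt (tnth_nth (gen le x0)) /= [symbol_set s]/(tuple_set (val s)).
rewrite sort_tuple_set // (nth_map x0) kj ?size_tuple //.
by congr gen; rewrite -tnth_nth.
Qed.

Lemma face_of_del_symbol t (s : symbol le t.+1)
    (k : 'I_#|val (face_of_symbol s)|) (j : 'I_t.+1) :
  k = j :> nat -> del_face k = face_of_symbol (del_symbol s j).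
Proof.
move=> kj; apply: val_inj => /=; rewrite (face_elt_face_of_symbol kj).
have /andP[inc _] := valP s.
have s_inj := increasing_inj inc.
apply/setP=> u; rewrite !inE; apply/andP/imsetP.
  case=> neq /imsetP[i _ def_u]; case: (unliftP j i) => [i' def_i|def_i].
    by exists i'; rewrite // tnth_mktuple -def_i.
  by rewrite def_u def_i eqxx in neq.
case=> i _ ->; rewrite tnth_mktuple; split; last by apply: imset_f.
by rewrite (inj_eq gen_inj) (inj_eq s_inj) eq_sym neq_lift.
Qed.

End Correspondence.

(** * The isomorphism of complexes *)

Section Pullback.
Variables (K : fieldType) (n : nat) (G : {fset 'X_{1..n}}) (le : rel G).
Local Notation R := {mpoly K[n]}.
Variable g : forall t, face le t -> symbol le t.

(** Coefficients are transported along the map g from faces to symbols.  In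
    degree 0 the source is the ring itself, and the target has the empty face as
    its only basis element. *)
Definition pullback t : Lyub K le t -> CLyub K le t :=
  match t return Lyub K le t -> CLyub K le t with
  | 0 => fun x => [ffun => x]
  | t'.+1 => fun x => [ffun F => (x : {ffun symbol le t'.+1 -> R^o}) (g F)]
  end.

Lemma pullback_is_linear t : linear (@pullback t).
Proof. by case: t => [|t] a x y; apply/ffunP => F; rewrite !ffunE. Qed.

HB.instance Definition _ t :=
  GRing.isLinear.Build R (Lyub K le t) (CLyub K le t) _ (@pullback t)
    (@pullback_is_linear t).

Variable f : forall t, symbol le t -> face le t.
Hypothesis fK : forall t, cancel (@f t) (@g t).
Hypothesis gK : forall t, cancel (@g t) (@f t).

Lemma face0E (F : face le 0) : F = empty_face le.
Proof.
by apply/val_inj/eqP; rewrite -cards_eq0; have /andP[] := valP F.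
Qed.

Lemma pullback_basis t (s : symbol le t) :
  pullback (Lyub_basis K s) = CLyub_basis K (f s).
Proof.
case: t s => [|t] s; apply/ffunP=> F; rewrite !ffunE.
  by rewrite (face0E F) (face0E (f s)) eqxx.
by rewrite (can2_eq (@gK _) (@fK _)).
Qed.

Lemma pullback_bij t : bijective (@pullback t).
Proof.
case: t => [|t].
  exists (fun y : {ffun face le 0 -> R^o} => y (empty_face le)) => x.
    by rewrite ffunE.
  by apply/ffunP=> F; rewrite ffunE (face0E F).
exists (fun y : {ffun face le t.+1 -> R^o} =>
  [ffun s => y (f s)] : {ffun symbol le t.+1 -> R^o}) => x.
  by apply/ffunP=> s; rewrite !ffunE fK.
by apply/ffunP=> F; rewrite !ffunE gK.
Qed.

End Pullback.

Section Differential.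
Variables (K : fieldType) (n : nat) (G : {fset 'X_{1..n}}) (le : rel G).
Hypothesis le_total : total_order le.
Hypothesis G_antichain : forall u v : G, (val u <= val v)%MM -> u = v.

Let f t := @face_of_symbol n G le le_total G_antichain t.
Let g t := @symbol_of_face n G le le_total G_antichain t.
Let fK t : cancel (@f t) (@g t) := @face_of_symbolK _ _ _ _ _ t.
Let gK t : cancel (@g t) (@f t) := @symbol_of_faceK _ _ _ _ _ t.

(** Terms correspond under the canonical bijection between the t.+1 positions of
    the symbol and the positions of its face, which keeps the values. *)
Lemma pullback_diff_basis t (s : symbol le t.+1) :
  pullback g (Lyub_diff_basis K s) = CLyub_diff_basis K (f s).
Proof.
rewrite linear_sum /CLyub_diff_basis.
have lcm_f t' (s' : symbol le t') :
    set_lcm (val (f s')) = tuple_lcm le (val s').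
  by have /andP[inc _] := valP s'; exact: set_lcm_tuple_set.
have card_f : #|val (f s)| = t.+1 by have /andP[_ /eqP] := valP (f s).
rewrite [RHS](reindex (cast_ord (esym card_f))) /=; last first.
  apply: onW_bij.
  by exists (cast_ord card_f); [exact: cast_ordKV | exact: cast_ordK].
apply: eq_bigr => j _; rewrite linearZ /= (pullback_basis K fK gK).
have del_f : del_face (cast_ord (esym card_f) j) = f (del_symbol s j).
  exact: face_of_del_symbol.
rewrite -del_f.
congr (_ *: _); congr (_ * 'X_[_]).
  by rewrite /face_sign -signr_odd /=; case: odd.
congr (_ - _)%MM; first by rewrite -lcm_f.
by rewrite -(lcm_f _ (del_symbol s j)) -del_f.
Qed.

Lemma pullback_diff t (x : Lyub K le t.+1) :
  pullback g (Lyub_diff x) = CLyub_diff (pullback g x).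
Proof.
rewrite /Lyub_diff linear_sum /CLyub_diff.
rewrite [RHS](reindex (@f t.+1)) /=; last first.
  exact: onW_bij (Bijective (@fK _) (@gK _)).
apply: eq_bigr => s _; rewrite linearZ -pullback_diff_basis /=.
by rewrite ffunE fK.
Qed.

End Differential.

Theorem corollary3p3 (K : fieldType) (n : nat) (I : zmodClosed {mpoly K[n]})
    (G : {fset 'X_{1..n}}) (le : rel G)
    (I_monomial : monomial_ideal I)
    (G_min_gen : min_monomial_generators I G)
    (le_total : total_order le) :
  exists phi : forall t : nat, {linear Lyub K le t -> CLyub K le t},
    [/\ forall t : nat, bijective (phi t),
        forall (t : nat) (s : symbol le t),
          exists2 F : face le t,
            val F = symbol_set s &
            phi t (Lyub_basis K s) = CLyub_basis K F,
        forall (t : nat) (F : face le t),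
          exists2 s : symbol le t,
            val F = symbol_set s &
            phi t (Lyub_basis K s) = CLyub_basis K F,
        forall (t : nat) (x : Lyub K le t.+1),
          phi t (Lyub_diff x) = CLyub_diff (phi t.+1 x) &
        forall x : Lyub K le 0, CLyub_aug I (phi 0%N x) = Lyub_aug I x].
Proof.
have anti (u v : G) : (val u <= val v)%MM -> u = v.
  move=> uv; apply: val_inj.
  exact: min_monomial_generators_antichain G_min_gen (valP u) (valP v) uv.
pose f t := @face_of_symbol n G le le_total anti t.
pose g t := @symbol_of_face n G le le_total anti t.
have fK t : cancel (f t) (g t) by exact: face_of_symbolK.
have gK t : cancel (g t) (f t) by exact: symbol_of_faceK.
exists (fun t => pullback (K := K) g (t := t)); split.
- by move=> t; apply: pullback_bij fK gK _.
- by move=> t s; exists (f t s); last exact: pullback_basis fK gK _ _.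
- move=> t F; exists (g t F); first by rewrite -{1}(gK t F).
  by rewrite /= (pullback_basis K fK gK) gK.
- by move=> t x; exact: pullback_diff.
by move=> x; rewrite /CLyub_aug ffunE.
Qed.
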